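(* Let $m,n>1$ be integers and let $P=[1,m]\times[1,n]$ as a subposet of $\mathbb{Z}^2$ with the componentwise ordering. Write a path $\pi\in\Pi_P$ as the ordered collection of vertices $(u_i,v_i)$, $1\le i\le m+n-1$, with $(u_1,v_1)=(1,1)$, $(u_{m+n-1},v_{m+n-1})=(m,n)$, and $(u_{i+1},v_{i+1})-(u_i,v_i)\in\{(0,1),(1,0)\}$. Then the number of extreme rays in $\mathscr{ER}(\pi)$ is $$\sum_{i=1}^{m+n-1}\binom{n+u_i-v_i-1}{u_i-1}\binom{m-u_i+v_i-1}{v_i-1}.$$
   Context: $[1,m]$ denotes the integer interval $\{1,\ldots,m\}$. $\Pi_P$ denotes the set of maximal chains of $P$, called paths. A path $\pi$ is identified with its indicator vector in $\mathbb{R}^P$, and $\langle\cdot,\cdot\rangle$ is the standard inner product on $\mathbb{R}^P$. With $\mathbb{R}_+=[0,\infty)$, for $\pi\in\Pi_P$, $$\mathcal{C}(\pi)=\{\omega\in\mathbb{R}_+^P:\langle\omega,\pi\rangle\ge\langle\omega,\pi'\rangle\text{ for all }\pi'\in\Pi_P\},$$ a polyhedral cone. $\mathscr{ER}(\pi)$ is the set of extreme rays of $\mathcal{C}(\pi)$, counted up to positive scaling. A nonzero $\omega\in\mathcal{C}(\pi)$ spans an extreme ray if whenever $\omega=\alpha\omega_1+\beta\omega_2$ with $\omega_1,\omega_2\in\mathcal{C}(\pi)$ and $\alpha,\beta>0$, both $\omega_1,\omega_2$ are nonnegative multiples of $\omega$. *)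

(* Defs.v *)
From mathcomp Require Import all_boot all_order all_algebra.
From mathcomp Require Import classical_sets cardinality reals.

Set Implicit Arguments.
Unset Strict Implicit.
Unset Printing Implicit Defensive.

Import Order.TTheory GRing.Theory Num.Theory.
Local Open Scope ring_scope.

(* The alias R^o, R as a module over itself, is what makes {ffun P -> R^o} = R^P
   an R-module. *)
Section PathCones.
Context (R : realType) (d : Order.disp_t) (P : finPOrderType d).
Implicit Types (p q : {set P}) (w : {ffun P -> R^o}).

Definition is_chain (A : {set P}) : bool :=
  [forall x in A, forall y in A, (x >=< y)%O].

Definition is_path p : bool := maxset is_chain p.

Definition indicator p : {ffun P -> R^o} := [ffun x => (x \in p)%:R].

Definition inner w1 w2 : R := \sum_x (w1 x : R) * w2 x.

Definition in_cone p w : Prop :=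
  (forall x, 0 <= w x :> R) /\
  (forall q, is_path q -> inner w (indicator q) <= inner w (indicator p)).

Definition spans_extreme_ray p w : Prop :=
  [/\ w != 0, in_cone p w &
      forall (w1 w2 : {ffun P -> R^o}) (a b : R),
        in_cone p w1 -> in_cone p w2 -> 0 < a -> 0 < b ->
        w = a *: w1 + b *: w2 ->
        (exists2 c : R, 0 <= c & w1 = c *: w) /\
        (exists2 c : R, 0 <= c & w2 = c *: w)].

(* The class of w up to positive scaling. *)
Definition ray w : set {ffun P -> R^o} :=
  [set w' | exists2 c : R, 0 < c & w' = c *: w]%classic.

Definition extreme_rays p : set (set {ffun P -> R^o}) :=
  [set r | exists2 w, spans_extreme_ray p w & r = ray w]%classic.

End PathCones.

Arguments extreme_rays R {d P} p.

(* [1,m] x [1,n] with the componentwise order; since 'I_m is {0, ..., m-1},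
   the element (i, j) stands for the lattice point (i + 1, j + 1). *)
Notation grid m n := ('I_m *p 'I_n)%type.

Local Close Scope ring_scope.

Definition lattice_point m n (x : grid m n) : nat * nat := (x.1.+1, x.2.+1).

(* p is the set of vertices (u i, v i), 1 <= i <= m + n - 1, of a lattice path
   from (1, 1) to (m, n); values of u and v at other indices are irrelevant. *)
Definition vertices_of_path m n (p : {set grid m n}) (u v : nat -> nat) : Prop :=
  [/\ (u 1, v 1) = (1, 1),
      (u (m + n - 1), v (m + n - 1)) = (m, n),
      (forall i, 1 <= i < m + n - 1 ->
         (u i.+1, v i.+1) = (u i, (v i).+1) \/
         (u i.+1, v i.+1) = ((u i).+1, v i)) &
      (forall x : grid m n, x \in p <->
         exists2 i, 1 <= i <= m + n - 1 & lattice_point x = (u i, v i))].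

(* Main.v *)
Require Import Defs.
From mathcomp Require Import all_boot all_order all_algebra.
From mathcomp Require Import classical_sets cardinality reals.
From mathcomp Require Import fintype finset zify lra.

Set Implicit Arguments.
Unset Strict Implicit.
Unset Printing Implicit Defensive.

Import Order.TTheory GRing.Theory Num.Theory.
Local Open Scope ring_scope.

(** In any finite poset the extreme rays of the cone of a path [p] are spanned
    by the indicators of the antichains that meet [p]; the theorem is this fact
    plus a count of antichains in the grid.

    A chain and an antichain share at most one point, so the indicator of an
    antichain [A] meeting [p] has value 1 on [p] and at most 1 on every path:
    it lies in the cone. If it is a positive combination of [w1] and [w2] in
    the cone, both are supported on [A], and each is largest at the point of
    [A] on [p], because a path through another point of [A] picks up just the
    value there. As the combination is constant on [A], so are [w1] and [w2]
    ([indicator_spans_extreme_ray]).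

    Conversely, for [w] nonzero in the cone, the minimal elements of its support
    form an antichain [A]. Every path of maximal weight meets [A]: otherwise
    its lowest point of positive weight could be preceded by a point of positive
    weight outside the path, giving a heavier chain. Hence [w] stays in the cone
    after a small multiple of the indicator of [A] is subtracted, and an extreme
    [w] must be a multiple of that indicator ([extreme_ray_indicator]).

    Each antichain meeting [p] contains exactly one point of [p], so the rays are
    counted by summing over [x] in [p] the number of antichains through [x]. In
    the grid, the points incomparable to [x] form two rectangles, north-west and
    south-east of [x], any two points of which are incomparable. The count is
    therefore a product of two numbers of antichains in rectangles, and the
    number of antichains in a [k] by [l] rectangle satisfies the Pascal rule
    of the binomial coefficient [k + l] choose [k]
    ([card_antichains_rectangle]). Finally a maximal chain of the grid has exactly
    one point of each rank ([path_ranks]), which gives its description as a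
    lattice path and turns the sum over its points into a sum over indices. *)

(** * Antichains and extreme rays *)

Lemma finite_pos_lower_bound (R : realType) (I : finType) (f : I -> R) :
  (forall i, 0 < f i) -> exists2 e : R, 0 < e & forall i, e <= f i.
Proof.
move=> f_gt0.
have bound_seq (s : seq I) :
    exists2 e : R, 0 < e & forall i, i \in s -> e <= f i.
  elim: s => [|i s [e e_gt0 le_ef]]; first by exists 1.
  exists (Num.min e (f i)); first by rewrite lt_min e_gt0 f_gt0.
  move=> j; rewrite in_cons ge_min => /predU1P[->|/le_ef ->] //.
  by rewrite lexx orbT.
have [e e_gt0 le_ef] := bound_seq (enum I).
by exists e => // i; rewrite le_ef ?mem_enum.
Qed.

Section ExtremeRays.
Context (R : realType) (d : Order.disp_t) (P : finPOrderType d).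
Implicit Types (p q A : {set P}) (w : {ffun P -> R^o}).

Definition is_antichain A : bool :=
  [forall x in A, forall y in A, (x <= y)%O ==> (x == y)].

Lemma is_antichainP A :
  reflect (forall x y, x \in A -> y \in A -> (x <= y)%O -> x = y)
          (is_antichain A).
Proof.
apply: (iffP forall_inP) => [h x y Ax Ay le_xy|h x Ax].
  by apply/eqP; move/forall_inP/(_ y Ay)/implyP: (h x Ax); apply.
by apply/forall_inP=> y Ay; apply/implyP=> le_xy; apply/eqP/h.
Qed.

Lemma is_chainP A :
  reflect (forall x y, x \in A -> y \in A -> (x >=< y)%O) (is_chain A).
Proof.
apply: (iffP forall_inP) => [h x y Ax Ay|h x Ax].
  by move/forall_inP: (h x Ax); apply.
by apply/forall_inP=> y Ay; apply: h.
Qed.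

Definition antichains_meeting p : {set {set P}} :=
  [set A | is_antichain A & ~~ [disjoint A & p]].

Lemma path_is_chain p : is_path p -> is_chain p.
Proof. exact: maxsetp. Qed.

Lemma path_mem p x : is_path p -> (forall y, y \in p -> (x >=< y)%O) -> x \in p.
Proof.
move=> path_p comp_x; have /is_chainP chain_p := path_is_chain path_p.
case/maxsetP: path_p => _ /(_ (x |: p)) <-; rewrite ?setU11 ?subsetUr //.
apply/is_chainP=> y z /setU1P[->|py] /setU1P[->|pz]; last exact: chain_p.
- exact: comparablexx.
- exact: comp_x.
- by rewrite comparable_sym comp_x.
Qed.

Lemma chain_in_path (C : {set P}) :
  is_chain C -> exists2 q : {set P}, is_path q & C \subset q.
Proof. by move=> /maxset_exists[q]; exists q. Qed.

Lemma path_through x : exists2 q : {set P}, is_path q & x \in q.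
Proof.
have : is_chain [set x].
  by apply/is_chainP=> y z /set1P-> /set1P->; exact: comparablexx.
by case/chain_in_path=> q path_q; rewrite sub1set; exists q.
Qed.

(** Two points of the intersection are comparable by the chain and hence equal
    by the antichain. *)
Lemma card_antichain_chain A q :
  is_antichain A -> is_chain q -> (#|A :&: q| <= 1)%N.
Proof.
move=> /is_antichainP antiA /is_chainP chain_q.
apply/card_le1_eqP=> x y /setIP[Ax qx] /setIP[Ay qy].
by case/orP: (chain_q x y qx qy) => ?; [apply/esym|]; exact: antiA.
Qed.

Lemma inner_indicator w q : inner w (indicator R q) = \sum_(x in q) (w x : R).
Proof.
rewrite [RHS]big_mkcond; apply: eq_bigr => x _.
by rewrite ffunE; case: ifP; rewrite ?mulr1 ?mulr0.
Qed.

Lemma inner_indicators A q :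
  inner (indicator R A) (indicator R q) = #|A :&: q|%:R.
Proof.
rewrite inner_indicator -sum1_card natr_sum big_mkcond [RHS]big_mkcond.
apply: eq_bigr => x _; rewrite ffunE inE andbC.
by case: (x \in q); case: (x \in A).
Qed.

(** The cone is defined by paths, but nonnegative weights only grow when a chain
    is extended to a path, so the bound holds for all chains. *)
Lemma chain_weight_le p w C : in_cone p w -> is_chain C ->
  \sum_(x in C) (w x : R) <= \sum_(x in p) (w x : R).
Proof.
move=> [w_ge0 max_p] /chain_in_path[q path_q sCq].
rewrite -[leRHS]inner_indicator; apply: le_trans (max_p q path_q).
rewrite inner_indicator big_mkcond [leRHS]big_mkcond /=.
apply: ler_sum => x _; case: ifP => [Cx|_]; first by rewrite (subsetP sCq).
by case: ifP.
Qed.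

Lemma in_cone_indicator p A : is_path p -> A \in antichains_meeting p ->
  in_cone p (indicator R A).
Proof.
move=> path_p; rewrite inE => /andP[antiA meetA]; split=> [x|q path_q].
  by rewrite ffunE ler0n.
rewrite !inner_indicators ler_nat.
apply: leq_trans (card_antichain_chain antiA (path_is_chain path_q)) _.
by rewrite card_gt0 setI_eq0.
Qed.

(** In a decomposition of the indicator both parts vanish off [A] and are
    bounded by their value at the point [x0] where [A] meets [p]; the weighted sum
    of these bounds is attained everywhere on [A], so both parts are constant
    there. *)
Lemma indicator_spans_extreme_ray p A :
  is_path p -> A \in antichains_meeting p ->
  spans_extreme_ray p (indicator R A).
Proof.
move=> path_p meetsA; have cone_A := in_cone_indicator path_p meetsA.
move: meetsA; rewrite inE => /andP[antiA /pred0Pn[x0 /= /andP[Ax0 px0]]].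
split=> //.
  by apply/negP=> /eqP/ffunP/(_ x0)/eqP; rewrite !ffunE Ax0 oner_eq0.
move=> w1 w2 a b cone1 cone2 a_gt0 b_gt0 defA.
have valA x : (x \in A)%:R = a * w1 x + b * w2 x :> R.
  by move/ffunP/(_ x): defA; rewrite !ffunE.
(* Paths through z and through x0 meet A nowhere else, so their weights are
   w z and w x0. *)
have le_x0 w : in_cone p w -> (forall x, x \notin A -> w x = 0) ->
    forall z, z \in A -> (w z : R) <= w x0.
  move=> cone_w w_supp z Az; have [q path_q qz] := path_through z.
  have sum_q q' y : is_path q' -> y \in q' -> y \in A ->
      \sum_(x in q') (w x : R) = w y.
    move=> path_q' qy Ay; rewrite (bigD1 y) //= big1 ?addr0 // => x.
    case/andP=> qx; apply: contraNeq => wx_neq0; have Ax : x \in A.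
      by apply/negPn/negP=> /w_supp/eqP; rewrite (negPf wx_neq0).
    have /card_le1_eqP := card_antichain_chain antiA (path_is_chain path_q').
    by move=> eq_Aq; apply/eqP/eq_Aq; apply/setIP.
  rewrite -(sum_q q z) // -(sum_q p x0) //.
  exact: chain_weight_le (path_is_chain path_q).
have ge0_1 x : 0 <= w1 x :> R by case: cone1.
have ge0_2 x : 0 <= w2 x :> R by case: cone2.
have supp x : x \notin A -> w1 x = 0 /\ w2 x = 0.
  move=> /negPf nAx; move: (valA x) (ge0_1 x) (ge0_2 x); rewrite nAx /= => e h1 h2.
  by split; apply/eqP; nra.
have const x : x \in A -> w1 x = w1 x0 /\ w2 x = w2 x0.
  move=> Ax; have := le_x0 _ cone1 (fun y ny => (supp y ny).1) x Ax.
  have := le_x0 _ cone2 (fun y ny => (supp y ny).2) x Ax.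
  move: (valA x) (valA x0); rewrite Ax Ax0 /= => e e0 h1 h2.
  by split; apply/eqP; nra.
split; [exists (w1 x0) | exists (w2 x0)] => //; apply/ffunP=> x; rewrite !ffunE.
  by have [/const[-> _]|/supp[-> _]] := boolP (x \in A);
    rewrite /GRing.scale /= ?mulr1 ?mulr0.
by have [/const[_ ->]|/supp[_ ->]] := boolP (x \in A);
  rewrite /GRing.scale /= ?mulr1 ?mulr0.
Qed.

Definition min_supp w : {set P} :=
  [set x | (w x != 0) && [forall y, (y < x)%O ==> (w y == 0)]].

Lemma min_supp_antichain w : is_antichain (min_supp w).
Proof.
apply/is_antichainP=> x y; rewrite !inE.
move=> /andP[wx _] /andP[_ /forallP/(_ x)].
rewrite (negPf wx) implybF => not_lt_xy.
by rewrite le_eqVlt (negPf not_lt_xy) orbF => /eqP.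
Qed.

Lemma cone_weight_gt0 p w : in_cone p w -> w != 0 ->
  0 < \sum_(x in p) (w x : R).
Proof.
move=> cone_w w_neq0; have [w_ge0 _] := cone_w.
have [x wx | w0] := pickP (fun x => w x != 0); last first.
  by case/eqP: w_neq0; apply/ffunP=> x; rewrite ffunE; apply/eqP/negbFE/w0.
have [q path_q qx] := path_through x.
apply: lt_le_trans (chain_weight_le cone_w (path_is_chain path_q)).
rewrite (bigD1 x) //= ltr_wpDr ?sumr_ge0 // lt_def wx; exact: w_ge0.
Qed.

(** Take the lowest point [x] of positive weight on a path [q] of maximal weight.
    A point [y < x] of positive weight would extend the part of [q] in the
    support to a chain heavier than [p]. *)
Lemma tight_path_meets_min_supp p w q :
  in_cone p w -> w != 0 -> is_path q ->
  \sum_(x in q) (w x : R) = \sum_(x in p) (w x : R) ->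
  ~~ [disjoint min_supp w & q].
Proof.
move=> cone_w w_neq0 path_q tight_q; have [w_ge0 _] := cone_w.
have /is_chainP chain_q := path_is_chain path_q.
have [x0 /andP[qx0 wx0] | w0] := pickP (fun x => (x \in q) && (w x != 0));
    last first.
  move: (cone_weight_gt0 cone_w w_neq0); rewrite -tight_q big1 ?ltxx // => x qx.
  by apply/eqP; move/negbT: (w0 x); rewrite qx /= negbK.
have /= : (x0 \in q) && (w x0 != 0) by rewrite qx0.
(* On a chain, having the fewest elements below means being lowest. *)
case: (@arg_minnP _ x0 (fun x => (x \in q) && (w x != 0))
  (fun x => #|[set y | (y < x)%O]|)); first by rewrite qx0.
move=> x /andP[qx wx] min_x _.
have le_x z : z \in q -> w z != 0 -> (x <= z)%O.
  move=> qz wz; case/orP: (chain_q x z qx qz) => //.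
  rewrite le_eqVlt => /orP[/eqP->//|lt_zx].
  have := min_x z; rewrite qz wz => /(_ isT); rewrite leqNgt => /negP[].
  apply/proper_card/properP; split; last by exists z; rewrite !inE ?ltxx.
  by apply/subsetP=> y; rewrite !inE => /lt_trans; apply.
apply/pred0Pn; exists x; rewrite /= qx andbT inE wx /=.
apply/forallP=> y; apply/implyP=> lt_yx; apply/negPn/negP=> wy.
pose C := y |: [set z in q | w z != 0].
have nCy : y \notin [set z in q | w z != 0].
  by rewrite inE; apply/negP=> /andP[qy _]; move: (le_x y qy wy); rewrite (lt_geF lt_yx).
have chain_C : is_chain C.
  have le_y z : z \in [set z in q | w z != 0] -> (y <= z)%O.
    by rewrite inE => /andP[qz /(le_x z qz)]; apply: le_trans (ltW lt_yx).
  apply/is_chainP=> z t /setU1P[->|Cz] /setU1P[->|Ct].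
  - exact: comparablexx.
  - by rewrite /Order.comparable le_y.
  - by rewrite /Order.comparable le_y ?orbT.
  - by move: Cz Ct; rewrite !inE => /andP[qz _] /andP[qt _]; apply: chain_q.
move: (chain_weight_le cone_w chain_C); rewrite -tight_q big_setU1 //=.
have -> : \sum_(z in [set z in q | w z != 0]) (w z : R) = \sum_(z in q) (w z : R).
  rewrite [RHS](bigID (fun z => w z != 0)) /= [X in _ = _ + X]big1 ?addr0.
    by apply: eq_bigl => z; rewrite inE.
  by move=> z /andP[_ /negPn/eqP].
rewrite gerDr leNgt lt_def wy; move: (w_ge0 y) => h; by rewrite h.
Qed.

(** Subtracting [e] times the indicator of [A = min_supp w] lowers the weight of
    [p] and of every other path of maximal weight by exactly [e]. It
    preserves the remaining inequalities if [e] is at most every gap between the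
    maximal weight and a smaller path weight, and nonnegativity if [e] is at most
    the values of [w] on [A]. Extremality of [w] then makes the indicator a
    multiple of [w]. *)
Lemma extreme_ray_indicator p w : is_path p -> spans_extreme_ray p w ->
  min_supp w \in antichains_meeting p /\
  exists2 c : R, 0 < c & w = c *: indicator R (min_supp w).
Proof.
move=> path_p [w_neq0 cone_w extreme_w]; have [w_ge0 max_p] := cone_w.
set A := min_supp w.
have meetsA : A \in antichains_meeting p.
  by rewrite inE min_supp_antichain (tight_path_meets_min_supp cone_w).
split=> //; have cone_A := in_cone_indicator path_p meetsA.
pose gap q : R := \sum_(x in p) w x - \sum_(x in q) w x.
have [e1 e1_gt0 le_e1] : exists2 e : R, 0 < e & forall x, x \in A -> e <= w x.
  have [|e e_gt0 le_e] := @finite_pos_lower_bound R P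
      (fun x => if x \in A then w x else 1).
    move=> x; case: ifP => // ; rewrite inE => /andP[wx _].
    by rewrite lt_def wx; apply: w_ge0.
  by exists e => // x Ax; move: (le_e x); rewrite Ax.
have [e2 e2_gt0 le_e2] : exists2 e : R, 0 < e &
    forall q, is_path q -> gap q != 0 -> e <= gap q.
  have [|e e_gt0 le_e] := @finite_pos_lower_bound R {set P}
      (fun q => if is_path q && (gap q != 0) then gap q else 1).
    move=> q; case: ifP => // /andP[path_q gap_q]; rewrite lt_def gap_q subr_ge0.
    exact: chain_weight_le (path_is_chain path_q).
  by exists e => // q path_q gap_q; move: (le_e q); rewrite path_q gap_q.
pose e := Num.min e1 e2.
have e_gt0 : 0 < e by rewrite lt_min e1_gt0.
have cone_rest : in_cone p (w - e *: indicator R A).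
  split=> [x|q path_q].
    rewrite !ffunE /GRing.scale /= subr_ge0.
    case: (boolP (x \in A)) => Ax; rewrite ?mulr1 ?mulr0 ?w_ge0 //.
    by rewrite (le_trans _ (le_e1 x Ax)) // ge_min lexx.
  have innerE q' : inner (w - e *: indicator R A) (indicator R q') =
      \sum_(x in q') w x - e * #|A :&: q'|%:R :> R.
    rewrite -inner_indicators !inner_indicator mulr_sumr -sumrB.
    by apply: eq_bigr => x _; rewrite !ffunE.
  have cardI q' : is_path q' -> ~~ [disjoint A & q'] -> #|A :&: q'| = 1%N.
    move=> path_q'; rewrite -setI_eq0 -card_gt0 => A_gt0; apply/eqP.
    by rewrite eqn_leq A_gt0 card_antichain_chain ?min_supp_antichain ?path_is_chain.
  have card_p : #|A :&: p| = 1%N.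
    by apply: cardI => //; move: meetsA; rewrite inE => /andP[].
  rewrite !innerE card_p.
  have [/eqP gap0|gap_neq0] := boolP (gap q == 0).
    have tight_q : \sum_(x in q) (w x : R) = \sum_(x in p) (w x : R).
      by apply/esym/eqP; rewrite -subr_eq0; apply/eqP.
    by rewrite tight_q cardI // (tight_path_meets_min_supp cone_w).
  have le_eq : e <= gap q by rewrite (le_trans _ (le_e2 q path_q gap_neq0)) // ge_min lexx orbT.
  have: 0 <= e * #|A :&: q|%:R by rewrite mulr_ge0 ?ler0n // ltW.
  by move: le_eq; rewrite /gap; lra.
have [|[c c_ge0 Ac] _] := extreme_w _ _ e 1 cone_A cone_rest e_gt0 ltr01.
  by rewrite scale1r addrC subrK.
have [x /= /andP[Ax _]] : exists x, (x \in A) && (x \in p).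
  by move: meetsA; rewrite inE => /andP[_ /pred0Pn].
have c_neq0 : c != 0.
  apply: contraTneq Ax => c0; move/ffunP/(_ x): Ac.
  by rewrite c0 scale0r !ffunE; case: (x \in A) => // /eqP; rewrite oner_eq0.
exists c^-1; first by rewrite invr_gt0 lt_def c_neq0.
by rewrite Ac scalerA mulVf // scale1r.
Qed.

Lemma ray_indicator_inj A B : ray (indicator R A) = ray (indicator R B) -> A = B.
Proof.
move=> eq_ray; have : ray (indicator R B) (indicator R A).
  by rewrite -eq_ray; exists 1; rewrite ?scale1r.
case=> c c_gt0 /ffunP AcB; apply/setP=> x; move: (AcB x); rewrite !ffunE.
rewrite /GRing.scale /=; case: (x \in A); case: (x \in B) => // /eqP.
  by rewrite mulr0 oner_eq0.
by rewrite mulr1 eq_sym gt_eqF.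
Qed.

Lemma ray_scale (c : R) w : 0 < c -> ray (c *: w) = ray w.
Proof.
move=> c_gt0; apply/seteqP; split=> w' [a a_gt0 ->].
  by exists (a * c); rewrite ?mulr_gt0 // scalerA.
by exists (a / c); rewrite ?divr_gt0 // scalerA divfK ?gt_eqF.
Qed.

Lemma card_extreme_rays p : is_path p ->
  (extreme_rays R p #= `I_#|antichains_meeting p|)%card.
Proof.
move=> path_p; pose S := enum (antichains_meeting p).
have -> : extreme_rays R p =
    ((fun i => ray (indicator R (nth set0 S i))) @`
      `I_#|antichains_meeting p|)%classic.
  rewrite cardE -/S; apply/seteqP; split=> [r [w ext_w ->]|r [i /= ltiS <-]].
    have [meetsA [c c_gt0 {1}->]] := extreme_ray_indicator path_p ext_w.
    exists (index (min_supp w) S); first by rewrite /= index_mem mem_enum.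
    by rewrite nth_index ?mem_enum // ray_scale.
  exists (indicator R (nth set0 S i)) => //.
  by apply: indicator_spans_extreme_ray; rewrite // -mem_enum mem_nth.
apply: inj_card_eq => i j; rewrite !in_setE /= cardE -/S => ltiS ltjS /ray_indicator_inj/eqP.
by rewrite nth_uniq ?enum_uniq // => /eqP.
Qed.

End ExtremeRays.

Local Close Scope ring_scope.

(** * Counting antichains in a finite poset *)

Section Antichains.
Context (d : Order.disp_t) (P : finPOrderType d).
Implicit Types (x z : P) (p A B S T : {set P}).

Definition antichains_in S : {set {set P}} :=
  [set A | is_antichain A & A \subset S].

Definition antichains_through x : {set {set P}} :=
  [set A | is_antichain A & x \in A].

Lemma is_antichain_sub A B : A \subset B -> is_antichain B -> is_antichain A.
Proof.
move=> /subsetP sAB /is_antichainP antiB.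
by apply/is_antichainP=> x y /sAB Bx /sAB By; apply: antiB.
Qed.

Lemma is_antichainU A B : is_antichain A -> is_antichain B ->
  {in A & B, forall x y, (x >< y)%O} -> is_antichain (A :|: B).
Proof.
move=> /is_antichainP antiA /is_antichainP antiB incompAB.
apply/is_antichainP=> x y /setUP[Ax|Bx] /setUP[Ay|By] le_xy.
- exact: antiA.
- by have := incompAB x y Ax By; rewrite /Order.comparable le_xy.
- by have := incompAB y x Ay Bx; rewrite /Order.comparable le_xy orbT.
- exact: antiB.
Qed.

Lemma is_antichain1 x : is_antichain [set x].
Proof. by apply/is_antichainP=> y z /set1P-> /set1P->. Qed.

Lemma card_antichains_in0 : #|antichains_in set0| = 1%N.
Proof.
rewrite (_ : antichains_in set0 = [set set0]) ?cards1 //.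
apply/setP=> A; rewrite !inE subset0 andbC.
by case: eqP => // ->; apply/is_antichainP=> x y; rewrite inE.
Qed.

Lemma antichains_inI S T :
  antichains_in S :&: antichains_in T = antichains_in (S :&: T).
Proof. by apply/setP=> A; rewrite !inE subsetI andbACA andbb. Qed.

(** Removing [z] from an antichain through [z] leaves an antichain of points
    incomparable to [z], and conversely. *)
Lemma card_antichains_in_through S z : z \in S ->
  #|antichains_in S :&: antichains_through z| =
  #|antichains_in [set x in S | (x >< z)%O]|.
Proof.
move=> Sz; set S' := [set x in S | _].
have nS'z : z \notin S' by rewrite inE comparablexx andbF.
rewrite -(@card_in_imset _ _ (fun A => z |: A) (antichains_in S')).
  apply: eq_card => A; apply/setIP/imsetP=> [[]|[B]]; rewrite !inE.
    move=> /andP[antiA sAS] /andP[_ Az]; exists (A :\ z); last by rewrite setD1K.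
    rewrite inE (is_antichain_sub (subsetDl _ _) antiA) /=.
    apply/subsetP=> x /setD1P[neq_xz Ax]; rewrite inE (subsetP sAS) //=.
    apply: contra neq_xz => /orP[le|le]; apply/eqP.
      exact: (is_antichainP _ antiA).
    by apply/esym; apply: (is_antichainP _ antiA).
  move=> /andP[antiB /subsetP sBS'] ->.
  have antizB : is_antichain (z |: B).
    apply: is_antichainU (is_antichain1 z) antiB _ => x y /set1P-> /sBS'.
    by rewrite inE comparable_sym => /andP[].
  rewrite antizB setU11 subUset sub1set Sz; split=> //=.
  by apply/subsetP=> x /sBS'; rewrite inE => /andP[].
move=> A B; rewrite !inE => /andP[_ sAS'] /andP[_ sBS'] eqU.
by rewrite -(setU1K (contra (subsetP sAS' z) nS'z)) eqU
  setU1K ?(contra (subsetP sBS' z) nS'z).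
Qed.

(** An antichain of the union is the union of its traces on [S] and [T], which can
    be chosen independently. *)
Lemma card_antichains_inU S T : {in S & T, forall x y, (x >< y)%O} ->
  #|antichains_in (S :|: T)| = (#|antichains_in S| * #|antichains_in T|)%N.
Proof.
move=> incompST; rewrite -cardsX.
have dST : S :&: T = set0.
  apply/setP=> x; rewrite !inE; apply/negP=> /andP[Sx Tx].
  by have := incompST x x Sx Tx; rewrite comparablexx.
have dTS : T :&: S = set0 by rewrite setIC.
rewrite -(@card_in_imset _ _ (fun AB => AB.1 :|: AB.2)
            (setX (antichains_in S) (antichains_in T))).
  apply: eq_card => A; apply/idP/imsetP=> [|[[B C]]]; rewrite !inE /=.
    move=> /andP[antiA sAST]; exists (A :&: S, A :&: T).
      by rewrite !inE /= !subsetIr !(is_antichain_sub (subsetIl _ _) antiA).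
    by rewrite /= -setIUr; apply/esym/setIidPl.
  move=> /andP[/andP[antiB sBS] /andP[antiC sCT]] ->.
  rewrite setUSS // andbT; apply: is_antichainU => // x y Bx Cy.
  by apply: incompST; [apply: (subsetP sBS) | apply: (subsetP sCT)].
move=> [A B] [A' B']; rewrite !inE /=.
move=> /andP[/andP[_ sAS] /andP[_ sBT]] /andP[/andP[_ sAS'] /andP[_ sBT']].
have partS (C D : {set P}) : C \subset S -> D \subset T -> (C :|: D) :&: S = C.
  move=> sCS sDT; rewrite setIUl (setIidPl sCS); apply/setUidPl.
  by apply: subset_trans (setSI _ sDT) _; rewrite dTS sub0set.
have partT (C D : {set P}) : C \subset S -> D \subset T -> (C :|: D) :&: T = D.
  move=> sCS sDT; rewrite setIUl (setIidPl sDT); apply/setUidPr.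
  by apply: subset_trans (setSI _ sCS) _; rewrite dST sub0set.
by move=> eqU; rewrite -(partS A B) // -[in X in (_, X) = _](partT A B) // eqU partS ?partT.
Qed.

(** An antichain meeting the chain [p] contains only one of its points, so the
    sum counts it once. *)
Lemma card_antichains_meeting p : is_chain p ->
  #|antichains_meeting p| = (\sum_(x in p) #|antichains_through x|)%N.
Proof.
move=> chain_p.
under eq_bigr do rewrite -sum1_card big_mkcond.
rewrite exchange_big -sum1_card big_mkcond; apply: eq_bigr => A _ /=.
rewrite inE; have [antiA|/negPf nantiA] := boolP (is_antichain A); last first.
  by rewrite big1 // => x _; rewrite inE nantiA.
have -> : (\sum_(x in p) (if A \in antichains_through x then 1 else 0) = #|A :&: p|)%N.
  rewrite -big_mkcondr sum1_card; apply: eq_card => x.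
  by rewrite unfold_in !inE antiA andbC.
rewrite /= -setI_eq0 -card_gt0.
by case: #|A :&: p| (card_antichain_chain antiA chain_p) => [|[]].
Qed.

End Antichains.

(** * Antichains and paths in the grid *)

Section Grid.
Context (m n : nat).
Implicit Types (x y : grid m n).

Lemma le_grid x y : (x <= y)%O = (x.1 <= y.1)%N && (x.2 <= y.2)%N.
Proof. by []. Qed.

Definition rectangle (a b c e : nat) : {set grid m n} :=
  [set x : grid m n | (a <= x.1 < b)%N && (c <= x.2 < e)%N].

(** Pascal's rule, applied to the corner [z] in the last row and the first column.
    An antichain through [z] uses neither that row nor that column again. An
    antichain avoiding [z] misses the whole row or the whole column, as a point
    in the row is above a point in the column. So the antichains through [z]
    are as many as those missing both, and by inclusion-exclusion the total is
    the number missing the row plus the number missing the column. *)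
Lemma card_antichains_rectangle a b c e :
  (a <= b <= m)%N -> (c <= e <= n)%N ->
  #|antichains_in (rectangle a b c e)| = 'C((b - a) + (e - c), b - a).
Proof.
move=> /andP[leab lebm] /andP[lece leen].
have: (b - a)%N = (b - a)%N by []; have: (e - c)%N = (e - c)%N by [].
move: {1 3 4}(b - a)%N => k; move: {1 3}(e - c)%N => l.
elim: k b c l leab lebm lece => [|k IHk] b c l leab lebm lece.
  move=> _ eqb; rewrite bin0 -[RHS](card_antichains_in0 (grid m n)).
  by congr #|antichains_in _|; apply/setP=> x; rewrite !inE; lia.
elim: l c lece => [|l IHl] c lece eqc eqb.
  rewrite addn0 binn -[RHS](card_antichains_in0 (grid m n)).
  by congr #|antichains_in _|; apply/setP=> x; rewrite !inE; lia.
have ltbm : (b.-1 < m)%N by lia.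
have ltcn : (c < n)%N by lia.
pose z : grid m n := (Ordinal ltbm, Ordinal ltcn).
rewrite -(cardsID (antichains_through z)) card_antichains_in_through; last first.
  by rewrite inE /=; lia.
have -> : [set x in rectangle a b c e | (x >< z)%O] = rectangle a b.-1 c.+1 e.
  apply/setP=> x; rewrite !inE /Order.comparable !le_grid /=; lia.
have -> : antichains_in (rectangle a b c e) :\: antichains_through z =
    antichains_in (rectangle a b.-1 c e) :|: antichains_in (rectangle a b c.+1 e).
  apply/setP=> A; rewrite !inE negb_and andbC andb_orr andbAC andbN /=.
  have [antiA|//] := boolP (is_antichain A).
  rewrite /=; apply/andP/orP=> [[sA nAz]|sA].
    have [/exists_inP[x Ax /eqP x1]|no_row] :=
        boolP [exists x in A, x.1 == b.-1 :> nat].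
      right; apply/subsetP=> y Ay; have := subsetP sA y Ay; rewrite !inE => yR.
      have neq_c t : t \in A -> t.1 = b.-1 :> nat -> t.2 != c :> nat.
        move=> At t1; apply: contra nAz => /eqP t2; suff <- : t = z by [].
        by case: t t1 t2 {At} => t1 t2 /= e1 e2; congr (_, _); apply: val_inj.
      have neq_yc : y.2 != c :> nat.
        apply/negP=> /eqP y2; have eq_yx : y = x.
          apply: (is_antichainP _ antiA) => //.
          rewrite le_grid y2 x1; have := subsetP sA x Ax; rewrite inE; lia.
        by have := neq_c x Ax x1; rewrite -eq_yx y2 eqxx.
      by move: yR neq_yc; case: y {Ay} => y1 y2 /=; lia.
    left; apply/subsetP=> y Ay; have := subsetP sA y Ay; rewrite !inE.
    move: no_row; rewrite negb_exists_in => /forall_inP/(_ y Ay).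
    by case: y {Ay} => y1 y2 /=; lia.
  split; last first.
    by apply/negP=> Az; case: sA => /subsetP/(_ z Az); rewrite inE /=; lia.
  by case: sA => /subsetP sA; apply/subsetP=> y /sA; rewrite !inE; lia.
have -> : rectangle a b.-1 c.+1 e = rectangle a b.-1 c e :&: rectangle a b c.+1 e.
  by apply/setP=> x; rewrite !inE; lia.
(* The antichains through z supply the intersection term of inclusion-exclusion. *)
rewrite -antichains_inI addnC cardsUI.
rewrite (IHk b.-1 c l.+1) ?(IHl c.+1); [|lia..].
by rewrite [(k.+1 + l.+1)%N]addSn binS addSnnS addnC.
Qed.
Lemma card_antichains_through_grid x :
  #|antichains_through x| =
    ('C(x.1 + (n - x.2.+1), x.1) * 'C((m - x.1.+1) + x.2, x.2))%N.
Proof.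
have [lt1 lt2] := (ltn_ord x.1, ltn_ord x.2).
have -> : antichains_through x = antichains_in setT :&: antichains_through x.
  by apply/setP=> A; rewrite !inE subsetT andbT; case: is_antichain.
rewrite card_antichains_in_through ?inE //.
set S := [set y in _ | _].
have -> : S = rectangle 0 x.1 x.2.+1 n :|: rectangle x.1.+1 m 0 x.2.
  apply/setP=> y; rewrite !inE /Order.comparable !le_grid.
  by case: x y {S lt1 lt2} => x1 x2 [y1 y2] /=; have [] := (ltn_ord y1, ltn_ord y2); lia.
rewrite card_antichains_inU; last first.
  move=> y z; rewrite !inE /Order.comparable !le_grid.
  by case: x y z {S lt1 lt2} => x1 x2 [y1 y2] [z1 z2] /=; lia.
rewrite !card_antichains_rectangle ?subn0; [|lia..].
by rewrite -(bin_sub (leq_addr x.2 (m - x.1.+1)%N)) addKn.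
Qed.

Definition rank x : nat := (x.1 + x.2)%N.

Lemma le_rank x y : (x >=< y)%O -> (rank x <= rank y)%N -> (x <= y)%O.
Proof. by rewrite /rank /Order.comparable !le_grid; lia. Qed.

Lemma rank_inj_chain (C : {set grid m n}) : is_chain C -> {in C &, injective rank}.
Proof.
move=> /is_chainP chainC x y Cx Cy eq_r; apply/le_anti.
by rewrite !le_rank ?eq_r ?chainC.
Qed.

Lemma rank_intermediate x z : (x <= z)%O -> (rank x < rank z)%N ->
  exists y, [/\ rank y = (rank x).+1, (x <= y)%O & (y <= z)%O].
Proof.
case: x z => [x1 x2] [z1 z2]; rewrite le_grid /rank /= => /andP[le1 le2] lt_xz.
have [lt1|ge1] := ltnP x1 z1.
  exists (Ordinal (leq_ltn_trans lt1 (ltn_ord z1)), x2).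
  by rewrite !le_grid /=; split; lia.
have lt2 : (x2 < z2)%N by lia.
exists (x1, Ordinal (leq_ltn_trans lt2 (ltn_ord z2))).
by rewrite !le_grid /=; split; lia.
Qed.

(** A rank skipped between consecutive points [x <= z] of [p] would be the rank
    of a point between them, comparable to all of [p], against maximality. *)
Lemma path_ranks (p : {set grid m n}) : (0 < m)%N -> (0 < n)%N -> is_path p ->
  forall r, (r < (m + n).-1)%N -> exists2 x, x \in p & rank x = r.
Proof.
move=> m_gt0 n_gt0 path_p; have /is_chainP chain_p := path_is_chain path_p.
have lt_pred k : (0 < k)%N -> (k.-1 < k)%N by lia.
elim=> [|r IHr] ltr.
  pose origin : grid m n := (Ordinal m_gt0, Ordinal n_gt0).
  have le_origin x : (origin <= x)%O by rewrite le_grid.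
  exists origin => //; apply: (path_mem path_p) => x _.
  by rewrite /Order.comparable le_origin.
have [|x px rx] := IHr; first by lia.
pose top : grid m n := (Ordinal (lt_pred m m_gt0), Ordinal (lt_pred n n_gt0)).
have le_top y : (y <= top)%O.
  by rewrite le_grid; case: y => y1 y2 /=; have [] := (ltn_ord y1, ltn_ord y2); lia.
have ptop : top \in p.
  by apply: path_mem => // y _; rewrite /Order.comparable le_top orbT.
have topP : (top \in p) && (r < rank top)%N by rewrite ptop /rank /=; lia.
case: (@arg_minnP _ top (fun y => (y \in p) && (r < rank y)%N) rank topP).
move=> z /andP[pz ltrz] min_z.
have le_xz : (x <= z)%O by apply: le_rank; rewrite ?chain_p // rx ltnW.
have [|y [ry le_xy le_yz]] := rank_intermediate le_xz; first by rewrite rx.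
rewrite rx in ry.
exists y => //; apply: path_mem => // t pt; rewrite /Order.comparable.
have [le_tr|lt_rt] := leqP (rank t) r.
  by rewrite (le_trans (le_rank (chain_p t x pt px) _) le_xy) ?rx ?orbT.
rewrite (le_trans le_yz) // le_rank ?chain_p // min_z // pt; exact: lt_rt.
Qed.

(** The [i]-th vertex is the point of [p] of rank [i - 1]; the successive points
    differ by 1 in rank, hence by a unit step. *)
Lemma path_vertices (p : {set grid m n}) : (0 < m)%N -> (0 < n)%N -> is_path p ->
  exists u v : nat -> nat, vertices_of_path p u v.
Proof.
move=> m_gt0 n_gt0 path_p; have chain_p := path_is_chain path_p.
have /is_chainP comp_p := chain_p.
pose origin : grid m n := (Ordinal m_gt0, Ordinal n_gt0).
pose vertex i := odflt origin [pick x in p | rank x == i.-1].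
have vertexP i : (1 <= i <= m + n - 1)%N -> vertex i \in p /\ rank (vertex i) = i.-1.
  move=> lei; have [|x px rx] := path_ranks m_gt0 n_gt0 path_p (r := i.-1).
    by lia.
  rewrite /vertex; case: pickP => [y /andP[py /eqP ry] //|/(_ x)].
  by rewrite px rx eqxx.
exists (fun i => (vertex i).1.+1), (fun i => (vertex i).2.+1); split.
- have [|_] := vertexP 1%N; first by lia.
  by rewrite /rank => r1; congr (_, _); lia.
- have [|_] := vertexP (m + n - 1)%N; first by lia.
  have [] := (ltn_ord (vertex (m + n - 1)).1, ltn_ord (vertex (m + n - 1)).2).
  by rewrite /rank => lt1 lt2 r1; congr (_, _); lia.
- move=> i lei; have [|pi ri] := vertexP i; first by lia.
  have [|pi' ri'] := vertexP i.+1; first by lia.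
  have : (vertex i <= vertex i.+1)%O.
    by apply: le_rank; [apply: comp_p | rewrite ri ri'; lia].
  move: ri ri'; rewrite le_grid /rank => ri ri' le_i.
  have [eq1|lt1] : (vertex i.+1).1 = (vertex i).1 :> nat \/
      (vertex i.+1).1 = (vertex i).1.+1 :> nat by lia.
    by left; congr (_, _); lia.
  by right; congr (_, _); lia.
- move=> x; split=> [px|[i lei [eq1 eq2]]].
    have lei : (1 <= (rank x).+1 <= m + n - 1)%N.
      by rewrite /rank; have [] := (ltn_ord x.1, ltn_ord x.2); lia.
    exists (rank x).+1 => //; have [pi ri] := vertexP _ lei.
    by rewrite (rank_inj_chain chain_p pi px ri).
  have [pi _] := vertexP i lei; suff -> : x = vertex i by [].
  by rewrite [x]surjective_pairing [RHS]surjective_pairing; congr (_, _); apply: val_inj.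
Qed.

End Grid.

(** The identity [u i + v i = i + 1] recovers the index from the vertex; the
    bounds follow from monotonicity and the two end points. *)
Lemma vertices_bounds m n (p : {set grid m n}) u v : vertices_of_path p u v ->
  forall i, (1 <= i <= m + n - 1)%N ->
  [/\ (u i + v i)%N = i.+1, (1 <= u i <= m)%N & (1 <= v i <= n)%N].
Proof.
move=> [start finish step _].
have mono i k : (1 <= i)%N -> (i + k <= m + n - 1)%N ->
    [/\ (u i <= u (i + k))%N, (v i <= v (i + k))%N &
        (u (i + k) + v (i + k) = u i + v i + k)%N].
  move=> i_gt0; elim: k => [|k IHk] leik; first by rewrite !addn0.
  have [|le_u le_v eq_uv] := IHk; first by lia.
  have [|[equ eqv]|[equ eqv]] := step (i + k)%N; first by lia.
    by rewrite addnS equ eqv; split; lia.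
  by rewrite addnS equ eqv; split; lia.
move: start finish => [u1 v1] [um vn] i /andP[i_gt0 lei].
have [||le_u1 le_v1 eq1] := mono 1%N i.-1; [lia..|].
have [||le_u le_v _] := mono i (m + n - 1 - i)%N; [lia..|].
move: le_u1 le_v1 eq1 le_u le_v; rewrite add1n prednK // subnKC // u1 v1 um vn.
by move=> *; split; lia.
Qed.

Lemma big_vertices m n (p : {set grid m n}) u v (G : nat -> nat -> nat) :
  (0 < m)%N -> (0 < n)%N -> vertices_of_path p u v ->
  (\sum_(x in p) G x.1.+1 x.2.+1 = \sum_(1 <= i < m + n) G (u i) (v i))%N.
Proof.
case: m n p => [|m] [|n] // p _ _ uvP; have bounds := vertices_bounds uvP.
have [_ _ _ memP] := uvP.
have predP a k : 0 < a <= k.+1 -> a.-1.+1 = a by lia.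
rewrite big_add1 big_mkord.
pose h (i : 'I_(m.+1 + n.+1).-1) : grid m.+1 n.+1 := (inord (u i.+1).-1, inord (v i.+1).-1).
have hE i : (h i).1.+1 = u i.+1 /\ (h i).2.+1 = v i.+1.
  have [|_ le_u le_v] := bounds i.+1; first by have := ltn_ord i; lia.
  have [eu ev] := (predP _ _ le_u, predP _ _ le_v).
  by rewrite /= !inordK ?eu ?ev //; [case/andP: le_v|case/andP: le_u].
have -> : p = [set h i | i : 'I_(m.+1 + n.+1).-1].
  apply/setP=> x; apply/idP/imsetP=> [/memP[i lei eqx]|[i _ ->]].
    have lti : (i.-1 < (m.+1 + n.+1).-1)%N by lia.
    exists (Ordinal lti) => //; have [] := hE (Ordinal lti).
    have -> : (Ordinal lti).+1 = i by rewrite /= prednK //; case/andP: lei.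
    case: eqx => <- <- [e1] [e2]; rewrite [LHS]surjective_pairing [RHS]surjective_pairing.
    by congr (_, _); apply: val_inj.
  apply/memP; exists i.+1; first by have := ltn_ord i; lia.
  by have [e1 e2] := hE i; rewrite /lattice_point e1 e2.
rewrite big_imset /=.
  by apply: eq_bigr => i _; have [-> ->] := hE i.
move=> i j _ _ eqh; apply: val_inj.
have [ui vi] := hE i; have [uj vj] := hE j; rewrite eqh in ui vi.
have [|eqi _ _] := bounds i.+1; first by have := ltn_ord i; lia.
have [|eqj _ _] := bounds j.+1; first by have := ltn_ord j; lia.
by apply: succn_inj; apply: succn_inj; rewrite -eqi -eqj -ui -vi uj vj.
Qed.

Theorem theorem2p7 (R : realType) (m n : nat) (hm : (1 < m)%N) (hn : (1 < n)%N)
    (p : {set grid m n}) (hp : is_path p) :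
  (exists u v : nat -> nat, vertices_of_path p u v) /\
  (forall u v : nat -> nat, vertices_of_path p u v ->
     (extreme_rays R p #=
      `I_(\sum_(1 <= i < m + n)
            'C(n + u i - v i - 1, u i - 1) *
            'C(m - u i + v i - 1, v i - 1))%N)%card).
Proof.
have [m_gt0 n_gt0] := (ltnW hm, ltnW hn).
split=> [|u v uvP]; first exact: path_vertices.
rewrite -(big_vertices
  (fun a b => 'C(n + a - b - 1, a - 1) * 'C(m - a + b - 1, b - 1)) m_gt0 n_gt0 uvP).
have <- : #|antichains_meeting p| = \sum_(x in p)
    'C(n + x.1.+1 - x.2.+1 - 1, x.1.+1 - 1) *
    'C(m - x.1.+1 + x.2.+1 - 1, x.2.+1 - 1); last exact: card_extreme_rays.
rewrite (card_antichains_meeting (path_is_chain hp)); apply: eq_bigr => x _.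
rewrite card_antichains_through_grid; case: x => x1 x2 /=.
have [lt1 lt2] := (ltn_ord x1, ltn_ord x2).
by congr (_ * _); congr 'C(_, _); lia.
Qed.
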